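(* Let $N=\{1,\ldots,n\}$, let $\boldsymbol\beta\in\mathbb{R}^n_+$ with $0=:\beta_0\le\beta_1\le\cdots\le\beta_n$. Let $L_1,\ldots,L_{k_l}$ be pairwise disjoint subsets of $N$ with union $N$ and $l_1,\ldots,l_{k_l}\in\mathbb{Z}_+$, and let $F_1,\ldots,F_{k_f}$ be pairwise disjoint subsets of $N$ with union $N$ and $f_1,\ldots,f_{k_f}\in\mathbb{Z}_+$. Define $$\mathcal{I}_X=\Big\{\mathbf{x}\in\{0,1\}^n:\ \sum_{i\in L_k}x_i\le l_k\ \ \forall k\in\{1,\ldots,k_l\}\Big\},$$ $$\mathcal{I}_Y(\mathbf{x})=\Big\{\mathbf{y}\in\{0,1\}^n:\ \mathbf{y}\le\mathbf{1}-\mathbf{x},\ \sum_{i\in F_k}y_i\le f_k\ \ \forall k\in\{1,\ldots,k_f\}\Big\}.$$ Then $$\min_{\mathbf{x}\in\mathcal{I}_X}\ \max_{\mathbf{y}\in\mathcal{I}_Y(\mathbf{x})}\boldsymbol\beta^\top\mathbf{y} =\min_{\mathbf{x}\in\mathcal{I}_X}\ \sum_{k=1}^{k_f}\ \min_{j_k\in\{0,\ldots,n\}}\Big\{\beta_{j_k}f_k+\sum_{i\in\widetilde F_k(j_k)}(\beta_i-\beta_{j_k})(1-x_i)\Big\},$$ where $\widetilde F_k(j_k)=F_k\cap\{j_k+1,\ldots,n\}$.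
   Context: The left-hand side is the partition matroid interdiction problem (PMI): a leader chooses $\mathbf{x}$ in the partition matroid $\mathcal I_X$, then a follower chooses $\mathbf{y}$ maximizing $\boldsymbol\beta^\top\mathbf y$ over $\mathcal I_Y(\mathbf x)$, and the leader minimizes the follower's optimal value. It is assumed $\sum_k l_k\le n$ and $\sum_k f_k\le n$. *)

(* Defs.v *)
(* Mathematical Components; the real numbers are replaced by an arbitrary
   ordered field. *)
From mathcomp Require Import all_boot all_order all_algebra.

Set Implicit Arguments.
Unset Strict Implicit.
Unset Printing Implicit Defensive.

Import Order.TTheory GRing.Theory Num.Theory.
Local Open Scope ring_scope.

(* Optimal values over a finite feasible set A.  The point x0 only witnesses
   that A is nonempty: by min_overP and max_overP the value does not depend
   on it as long as x0 \in A. *)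
Definition min_over (R : realFieldType) (T : finType) (x0 : T) (A : {set T})
    (F : T -> R) : R :=
  F [arg min_(x < x0 in A) F x]%O.

Definition max_over (R : realFieldType) (T : finType) (x0 : T) (A : {set T})
    (F : T -> R) : R :=
  F [arg max_(x > x0 in A) F x]%O.

Lemma min_overP (R : realFieldType) (T : finType) (x0 : T) (A : {set T})
    (F : T -> R) : x0 \in A ->
  (exists2 x, x \in A & min_over x0 A F = F x) /\
  (forall x, x \in A -> min_over x0 A F <= F x).
Proof.
by move=> x0A; rewrite /min_over; case: arg_minP => // x xA minx; split=> //; exists x.
Qed.

Lemma max_overP (R : realFieldType) (T : finType) (x0 : T) (A : {set T})
    (F : T -> R) : x0 \in A ->
  (exists2 x, x \in A & max_over x0 A F = F x) /\
  (forall x, x \in A -> F x <= max_over x0 A F).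
Proof.
by move=> x0A; rewrite /max_over; case: arg_maxP => // x xA maxx; split=> //; exists x.
Qed.

Definition bvec (n : nat) := {ffun 'I_n -> bool}.

Definition bvec0 (n : nat) : bvec n := [ffun=> false].

Definition set_partition (n k : nat) (P : 'I_k -> {set 'I_n}) : Prop :=
  (forall a b : 'I_k, a != b -> [disjoint P a & P b]) /\
  \bigcup_(a < k) P a = [set: 'I_n].

(* The ground set {1, ..., n} is represented by 'I_n, the ordinal i standing
   for the item i + 1.  Item labels in {0, ..., n} live in 'I_n.+1, where the
   label of i is lift ord0 i. *)
Definition label (n : nat) (i : 'I_n) : 'I_n.+1 := lift ord0 i.

(* (beta_0, beta_1, ..., beta_n) with beta_0 = 0. *)
Definition beta_ext (R : realFieldType) (n : nat) (beta : 'I_n -> R)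
    (j : 'I_n.+1) : R :=
  if unlift ord0 j is Some i then beta i else 0.

Definition IX (n kl : nat) (L : 'I_kl -> {set 'I_n}) (l : 'I_kl -> nat) :
    {set bvec n} :=
  [set x : bvec n | [forall k, (\sum_(i in L k) x i <= l k)%N]].

Definition IY (n kf : nat) (F : 'I_kf -> {set 'I_n}) (f : 'I_kf -> nat)
    (x : bvec n) : {set bvec n} :=
  [set y : bvec n | [forall i, (y i <= 1 - x i)%N]
                  & [forall k, (\sum_(i in F k) y i <= f k)%N]].

Definition Ftilde (n : nat) (Fk : {set 'I_n}) (j : 'I_n.+1) : {set 'I_n} :=
  [set i in Fk | (j < label i)%N].

Lemma label_val (n : nat) (i : 'I_n) : label i = i.+1 :> nat.
Proof. exact: lift0. Qed.

Lemma beta_ext0 (R : realFieldType) (n : nat) (beta : 'I_n -> R) :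
  beta_ext beta ord0 = 0.
Proof. by rewrite /beta_ext unlift_none. Qed.

Lemma beta_ext_label (R : realFieldType) (n : nat) (beta : 'I_n -> R)
    (i : 'I_n) : beta_ext beta (label i) = beta i.
Proof. by rewrite /beta_ext liftK. Qed.

Lemma bvec0_IX (n kl : nat) (L : 'I_kl -> {set 'I_n}) (l : 'I_kl -> nat) :
  bvec0 n \in IX L l.
Proof.
by rewrite inE; apply/forallP => k; rewrite big1 // => i _; rewrite ffunE.
Qed.

Lemma bvec0_IY (n kf : nat) (F : 'I_kf -> {set 'I_n}) (f : 'I_kf -> nat)
    (x : bvec n) : bvec0 n \in IY F f x.
Proof.
rewrite inE; apply/andP; split; apply/forallP => k; first by rewrite ffunE.
by rewrite big1 // => i _; rewrite ffunE.
Qed.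

(* Main.v *)
(* For a fixed x the follower's problem splits over the blocks F k, and on each
   block it is a uniform matroid on the available items A = F k minus x.  The
   bracket at j is the value of a dual solution with multiplier beta_j on the
   cardinality constraint, so it bounds every feasible choice; it is attained
   by the set of available items above the smallest threshold j that leaves at
   most f k of them, since then either j = 0 (multiplier zero) or exactly f k
   items are chosen. *)
Require Import Defs.
From mathcomp Require Import all_boot all_order all_algebra.

Set Implicit Arguments.
Unset Strict Implicit.
Unset Printing Implicit Defensive.

Import Order.TTheory GRing.Theory Num.Theory.
Local Open Scope ring_scope.

(** Each minimum is at most the value at the other's minimizer, so pointwise equality suffices. *)
Lemma eq_min_over (R : realFieldType) (T : finType) (x0 : T) (A : {set T})
    (F G : T -> R) : x0 \in A -> F =1 G -> min_over x0 A F = min_over x0 A G.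
Proof.
move=> x0A eqFG.
have [[x xA defF] minF] := min_overP F x0A.
have [[z zA defG] minG] := min_overP G x0A.
by apply/le_anti; rewrite {1}defG -eqFG minF // defF eqFG minG.
Qed.

Section Threshold.

Variables (R : realFieldType) (n : nat) (b : 'I_n.+1 -> R).
Hypotheses (b0 : b ord0 = 0)
  (b_mono : forall i j : 'I_n.+1, (i <= j)%N -> b i <= b j).

(** The bracket of the formula, with the factors [1 - x i] absorbed into the set [A] of available
    items. *)
Definition threshold_value (A : {set 'I_n}) (m : nat) (j : 'I_n.+1) : R :=
  b j * m%:R + \sum_(i in Ftilde A j) (b (label i) - b j).

(** Weak duality: each chosen item pays the price [b j], at most [m] times, and keeps the surplus
    [b (label i) - b j]. *)
Lemma sum_le_threshold_value (A B : {set 'I_n}) (m : nat) (j : 'I_n.+1) :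
  B \subset A -> (#|B| <= m)%N ->
  \sum_(i in B) b (label i) <= threshold_value A m j.
Proof.
move=> sBA leBm.
have bj_ge0 : 0 <= b j by rewrite -b0 b_mono.
have -> : \sum_(i in B) b (label i)
    = b j * #|B|%:R + \sum_(i in B) (b (label i) - b j).
  by rewrite sumrB sumr_const mulr_natr addrC subrK.
apply: lerD; first by rewrite ler_wpM2l // ler_nat.
(* Termwise: chosen items up to [j] have surplus at most 0, and unchosen available items above [j]
   only add to the right. *)
rewrite big_mkcond [leRHS]big_mkcond; apply: ler_sum => i _; rewrite inE.
have [iB|_] := boolP (i \in B).
  rewrite (subsetP sBA) //=; case: ltnP => // le_ij.
  by rewrite subr_le0 b_mono.
by case: ifP => // /andP[_ lt_ji]; rewrite subr_ge0 b_mono // ltnW.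
Qed.

Lemma threshold_value_attained (A : {set 'I_n}) (m : nat) :
  exists j : 'I_n.+1, (#|Ftilde A j| <= m)%N /\
    \sum_(i in Ftilde A j) b (label i) = threshold_value A m j.
Proof.
have max_ok : (#|Ftilde A ord_max| <= m)%N.
  rewrite (_ : Ftilde A ord_max = set0) ?cards0 //.
  by apply/setP => i; rewrite !inE label_val ltnS leqNgt ltn_ord andbF.
pose ok j := (#|Ftilde A j| <= m)%N.
case: (@arg_minnP _ ord_max ok (@nat_of_ord _) max_ok) => j.
rewrite {}/ok => le_m min_j.
exists j; split=> //; rewrite /threshold_value sumrB sumr_const.
(* Complementary slackness: a nonzero price requires the cardinality bound to be tight. *)
suff -> : b j * m%:R = b j *+ #|Ftilde A j| by rewrite addrC subrK.
rewrite mulr_natr; case: (unliftP ord0 j) => [i def_j|->]; last first.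
  by rewrite b0 !mul0rn.
congr (_ *+ _); apply/anti_leq; rewrite le_m andbT.
(* As a threshold, [j'] is [j - 1]; by minimality of [j] it leaves more than [m] items. *)
set j' : 'I_n.+1 := widen_ord (leqnSn n) i.
have gt_m : (m < #|Ftilde A j'|)%N.
  rewrite ltnNge; apply/negP => /min_j.
  by rewrite def_j label_val /= ltnn.
rewrite -ltnS; apply: leq_trans gt_m _.
(* Lowering the threshold by one adds at most the item [i], whose label is [j]. *)
have /subset_leq_card : Ftilde A j' \subset i |: Ftilde A j.
  apply/subsetP => t; rewrite !inE def_j !label_val !ltnS /=.
  by case/andP=> ->; rewrite leq_eqVlt eq_sym.
by move/leq_trans; apply; rewrite cardsU1; case: (_ \notin _).
Qed.

End Threshold.

Section Follower.

Variables (R : realFieldType) (n : nat) (beta : 'I_n -> R).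
Hypothesis beta_mono : forall i j : 'I_n.+1,
  (i <= j)%N -> beta_ext beta i <= beta_ext beta j.
Variables (kf : nat) (F : 'I_kf -> {set 'I_n}) (f : 'I_kf -> nat).
Hypothesis F_part : set_partition F.
Variable x : bvec n.

Let avail (k : 'I_kf) : {set 'I_n} := [set i in F k | ~~ x i].

(** After exchanging the sums, each item is counted once, in the only block containing it. *)
Lemma sum_over_partition (G : 'I_n -> R) :
  \sum_i G i = \sum_k \sum_(i in F k) G i.
Proof.
case: F_part => disjF covF.
rewrite (exchange_big_dep predT) //=; apply: eq_bigr => i _.
have: i \in \bigcup_k F k by rewrite covF inE.
case/bigcupP => k _ iFk; rewrite (bigD1 k) //= big1 ?addr0 // => a /andP[iFa neq_ak].
by have /disjointFr/(_ iFa) := disjF _ _ neq_ak; rewrite iFk.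
Qed.

Lemma sum_bvec (y : bvec n) (A : {set 'I_n}) (G : 'I_n -> R) :
  \sum_(i in A) G i * (y i)%:R = \sum_(i in [set i in A | y i]) G i.
Proof.
rewrite big_mkcond [RHS]big_mkcond; apply: eq_bigr => i _; rewrite inE.
by case: (i \in A); case: (y i); rewrite ?mulr1 ?mulr0.
Qed.

Lemma card_bvec (y : bvec n) (A : {set 'I_n}) :
  (\sum_(i in A) y i)%N = #|[set i in A | y i]|.
Proof.
rewrite -sum1_card big_mkcond [RHS]big_mkcond; apply: eq_bigr => i _.
by rewrite inE; case: (i \in A); case: (y i).
Qed.

Lemma threshold_valueE (k : 'I_kf) (j : 'I_n.+1) :
  beta_ext beta j * (f k)%:R
    + \sum_(i in Ftilde (F k) j) (beta i - beta_ext beta j) * (1 - (x i)%:R)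
  = threshold_value (beta_ext beta) (avail k) (f k) j.
Proof.
congr (_ + _); rewrite big_mkcond [RHS]big_mkcond; apply: eq_bigr => i _.
rewrite !inE beta_ext_label.
by case: (i \in F k); case: (x i); rewrite //= ?subrr ?mulr0 ?if_same // subr0 mulr1.
Qed.

Lemma follower_value :
  max_over (bvec0 n) (IY F f x) (fun y => \sum_(i < n) beta i * (y i)%:R)
  = \sum_(k < kf) min_over ord0 [set: 'I_n.+1] (fun j =>
      beta_ext beta j * (f k)%:R
      + \sum_(i in Ftilde (F k) j)
          (beta i - beta_ext beta j) * (1 - (x i)%:R)).
Proof.
have b0 := beta_ext0 beta.
pose g k j := beta_ext beta j * (f k)%:R
  + \sum_(i in Ftilde (F k) j) (beta i - beta_ext beta j) * (1 - (x i)%:R).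
have gP k := min_overP (g k) (in_setT ord0).
pose Y (y : bvec n) := \sum_(i < n) beta i * (y i)%:R.
have [[y yIY ->] maxY] := max_overP Y (bvec0_IY F f x).
apply/le_anti/andP; split.
  (* Upper bound: on each block, weak duality applies to an optimal [y] and a minimizing
     threshold. *)
  rewrite /Y sum_over_partition; apply: ler_sum => k _.
  have [[j _ ->] _] := gP k; rewrite /g threshold_valueE sum_bvec.
  move: yIY; rewrite inE => /andP[/forallP yx /forallP yf].
  under eq_bigr do rewrite -beta_ext_label.
  apply: sum_le_threshold_value => //; last by rewrite -card_bvec.
  apply/subsetP => i; rewrite !inE => /andP[-> yi].
  by move: (yx i); rewrite yi; case: (x i).
have /fin_all_exists[j jP] k :=
  threshold_value_attained b0 (avail k) (f k).
(* The blockwise optimal sets are glued into one follower solution; disjointness of the blocks lets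
   each be recovered from [z]. *)
pose z : bvec n := [ffun i => [exists k, i \in Ftilde (avail k) (j k)]].
have zF k : [set i in F k | z i] = Ftilde (avail k) (j k).
  apply/setP => i; rewrite inE ffunE; apply/andP/idP => [[iFk]|iS].
    case/existsP => a iS; case: (eqVneq a k) iS => [-> //|neq_ak].
    rewrite !inE => /andP[/andP[iFa _] _].
    by have /disjointFr/(_ iFa) := F_part.1 _ _ neq_ak; rewrite iFk.
  split; last by apply/existsP; exists k.
  by move: iS; rewrite !inE => /andP[/andP[]].
have zIY : z \in IY F f x.
  rewrite inE; apply/andP; split; apply/forallP => k; last first.
    by rewrite card_bvec zF; case: (jP k).
  rewrite ffunE; case: existsP => // -[a].
  by rewrite !inE => /andP[/andP[_ /negbTE ->]].
(* Lower bound: on block [k], [z] earns the bracket at [j k], which is at least its minimum over all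
   thresholds. *)
apply: le_trans (maxY _ zIY); rewrite /Y sum_over_partition.
apply: ler_sum => k _; rewrite sum_bvec zF.
under [leRHS]eq_bigr do rewrite -beta_ext_label.
have [_ ->] := jP k; rewrite -threshold_valueE.
by have [_ ->] := gP k; rewrite ?inE.
Qed.

End Follower.

Theorem theorem2 (R : realFieldType) (n : nat) (beta : 'I_n -> R)
    (beta_ge0 : forall i : 'I_n, 0 <= beta i)
    (beta_mono : forall i j : 'I_n.+1,
       (i <= j)%N -> beta_ext beta i <= beta_ext beta j)
    (kl : nat) (L : 'I_kl -> {set 'I_n}) (l : 'I_kl -> nat)
    (L_part : set_partition L) (l_le : (\sum_(k < kl) l k <= n)%N)
    (kf : nat) (F : 'I_kf -> {set 'I_n}) (f : 'I_kf -> nat)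
    (F_part : set_partition F) (f_le : (\sum_(k < kf) f k <= n)%N) :
  min_over (bvec0 n) (IX L l) (fun x : bvec n =>
    max_over (bvec0 n) (IY F f x) (fun y : bvec n =>
      \sum_(i < n) beta i * (y i)%:R))
  = min_over (bvec0 n) (IX L l) (fun x : bvec n =>
      \sum_(k < kf)
        min_over ord0 [set: 'I_n.+1] (fun j : 'I_n.+1 =>
          beta_ext beta j * (f k)%:R
          + \sum_(i in Ftilde (F k) j)
              (beta i - beta_ext beta j) * (1 - (x i)%:R))).
Proof.
by apply: eq_min_over => [|x]; [exact: bvec0_IX|exact: follower_value].
Qed.
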